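(* Let $\Theta$ be an involutive antimorphism on $\mathcal{A}^*$. If $\mathbf{u}$ is a recurrent infinite word over $\mathcal{A}$ with finite $\Theta$-defect, then $\mathbf{u}$ contains infinitely many overlapping factors, i.e., the set $$\{ www' \in \mathcal{L}(\mathbf{u}) \mid w' \text{ is a non-empty prefix of } w\}$$ is infinite.
   Context: An antimorphism on $\mathcal{A}^*$ is a map $\Theta$ with $\Theta(vw)=\Theta(w)\Theta(v)$ for all words $v,w$; it is involutive if $\Theta^2=\mathrm{Id}$. A word $w$ is a $\Theta$-palindrome if $\Theta(w)=w$. $\mathcal{L}(\mathbf{u})$ denotes the set of all (finite) factors of $\mathbf{u}$. $\mathbf{u}$ is recurrent if every factor occurs at least twice in $\mathbf{u}$. For a finite word $w$, $\mathrm{Pal}_\Theta(w)$ is the set of $\Theta$-palindromic factors of $w$ (including the empty word), and $\gamma_\Theta(w)$ is the number of unordered pairs $\{a,\Theta(a)\}$ with $a$ a letter occurring in $w$ and $a\neq\Theta(a)$. The $\Theta$-defect of $w$ is $D_\Theta(w)=|w|+1-\gamma_\Theta(w)-\#\mathrm{Pal}_\Theta(w)$, and the $\Theta$-defect of $\mathbf{u}$ is $\sup\{D_\Theta(w): w\in\mathcal{L}(\mathbf{u})\}$.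
   Formalization: The alphabet is assumed finite (the usual convention, not stated above); over an infinite alphabet the claim fails, e.g. for the square-free limit of p_{n+1} = p_n a_n p_n with distinct letters a_n, which is recurrent and has defect 0 for reversal. *)

(* Defs.v *)
From mathcomp Require Import all_boot all_order all_algebra.
From mathcomp Require Import boolp classical_sets cardinality.

Set Implicit Arguments.
Unset Strict Implicit.
Unset Printing Implicit Defensive.

(* Finite words over A are sequences, infinite words are functions nat -> A. *)

Definition antimorphism (A : finType) (Theta : seq A -> seq A) : Prop :=
  forall v w : seq A, Theta (v ++ w) = Theta w ++ Theta v.

Definition palindrome (A : finType) (Theta : seq A -> seq A) (w : seq A) : bool :=
  Theta w == w.

Definition occurs_at (A : finType) (u : nat -> A) (w : seq A) (i : nat) : Prop :=
  w = [seq u k | k <- iota i (size w)].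

Definition language (A : finType) (u : nat -> A) : set (seq A) :=
  fun w => exists i : nat, occurs_at u w i.

Definition recurrent (A : finType) (u : nat -> A) : Prop :=
  forall w : seq A, language u w ->
    exists i j : nat, [/\ i != j, occurs_at u w i & occurs_at u w j].

Definition factors (A : finType) (w : seq A) : seq (seq A) :=
  undup [seq take k (drop i w) | i <- iota 0 (size w).+1, k <- iota 0 (size w).+1].

Lemma mem_factors (A : finType) (v w : seq A) : (v \in factors w) = infix v w.
Proof.
rewrite mem_undup; apply/allpairsP/infixP => [[[i k] /= [_ _ ->]]|[s [t ->]]].
  exists (take i w), (drop k (drop i w)).
  by rewrite cat_take_drop cat_take_drop.
exists (size s, size v).
rewrite !mem_iota !add0n !size_cat !ltnS drop_size_cat // take_size_cat //.
by split; rewrite //= ?leq_addr // addnCA leq_addr.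
Qed.

Definition Pal (A : finType) (Theta : seq A -> seq A) (w : seq A) : seq (seq A) :=
  [seq v <- factors w | palindrome Theta v].

(* The pair {a, Theta(a)} as a set of letters: an involutive antimorphism sends
   one-letter words to one-letter words, so this set consists of a and of the
   unique b with Theta [:: a] = [:: b]. *)
Definition letter_pair (A : finType) (Theta : seq A -> seq A) (a : A) : {set A} :=
  [set b | (b == a) || ([:: b] == Theta [:: a])]%SET.

Definition gamma (A : finType) (Theta : seq A -> seq A) (w : seq A) : nat :=
  #|[set letter_pair Theta a | a in w & [:: a] != Theta [:: a]]%SET|.

(* Integer-valued, so that the subtractions are not truncated. *)
Definition defect (A : finType) (Theta : seq A -> seq A) (w : seq A) : int :=
  ((size w)%:Z + 1 - (gamma Theta w)%:Z - (size (Pal Theta w))%:Z)%R.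

Definition is_defect_of (A : finType) (Theta : seq A -> seq A) (u : nat -> A)
    (D : int) : Prop :=
  (forall w : seq A, language u w -> (defect Theta w <= D)%R) /\
  (forall M : int, (forall w : seq A, language u w -> (defect Theta w <= M)%R) ->
     (D <= M)%R).

(* The supremum of the defects of the factors of u exists in the integers; as
   defects are integers and the language is non-empty, this is finiteness of the
   supremum taken in the extended reals. *)
Definition finite_defect (A : finType) (Theta : seq A -> seq A) (u : nat -> A) : Prop :=
  exists D : int, is_defect_of Theta u D.

Definition overlapping_factors (A : finType) (u : nat -> A) : set (seq A) :=
  fun x => exists w w' : seq A,
    [/\ x = w ++ w ++ w', w' != [::], prefix w' w & language u x].

(* Main.v *)
Require Import Defs.
From mathcomp Require Import all_boot all_order all_algebra.
From mathcomp Require Import boolp classical_sets cardinality.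
From mathcomp Require Import zify.

Set Implicit Arguments.
Unset Strict Implicit.
Unset Printing Implicit Defensive.

(* Passing from the prefix of length n to that of length n+1 adds at most one
   palindrome, so finite defect forces the longest palindromic suffix (lps) of
   every long prefix to occur only once in it; in particular its length tends to
   infinity.  Let sigma(n) be the position where it starts.  Suppose only finitely
   many overlaps occur, so that distinct occurrences of a long word are disjoint.
   If the lps q of the prefix of length j is not extended on both sides at the
   next step, then every later lps starts after sigma(j): one reaching back to
   sigma(j) would contain q and a mirror image of a previous lps overlapping that
   lps.  But by recurrence q occurs again, and the lps ending with the next
   occurrence of q starts at sigma(j), a contradiction. *)

(** * Antimorphisms, windows of [u] and mirror images *)

(** [Theta] fixes the empty word, so it cannot erase a letter and never shortens a word; being its
    own inverse, it never lengthens one. *)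
Lemma size_involutive_antimorphism (A : finType) (Theta : seq A -> seq A) :
  antimorphism Theta -> involutive Theta -> forall w, size (Theta w) = size w.
Proof.
move=> Tanti Tinv.
have T0 : Theta [::] = [::].
  have /(congr1 size) := Tanti [::] [::]; rewrite cat0s size_cat => sz.
  by apply: size0nil; lia.
have le w : size w <= size (Theta w).
  elim: w => [|a w IHw] //.
  rewrite -cat1s Tanti !size_cat addnC leq_add //.
  rewrite lt0n size_eq0; apply/eqP => Ta.
  by have := Tinv [:: a]; rewrite Ta T0.
by move=> w; apply/eqP; rewrite eqn_leq le -{2}[w]Tinv le.
Qed.

Definition window (A : finType) (u : nat -> A) (a b : nat) : seq A :=
  [seq u k | k <- index_iota a b].

Lemma size_window (A : finType) (u : nat -> A) a b : size (window u a b) = b - a.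
Proof. by rewrite size_map size_iota. Qed.

Lemma window_cat (A : finType) (u : nat -> A) a b c :
  a <= b <= c -> window u a c = window u a b ++ window u b c.
Proof.
move=> /andP[ab bc]; rewrite /window /index_iota -map_cat.
have -> : c - a = (b - a) + (c - b) by lia.
by rewrite iotaD subnKC.
Qed.

Lemma nth_window (A : finType) (u : nat -> A) x0 a b i :
  i < b - a -> nth x0 (window u a b) i = u (a + i).
Proof. by move=> ib; rewrite (nth_map 0) ?size_iota// nth_iota. Qed.

Lemma window_language (A : finType) (u : nat -> A) a b : language u (window u a b).
Proof. by exists a; rewrite /occurs_at size_window. Qed.

Lemma infix_window (A : finType) (u : nat -> A) n v :
  infix v (window u 0 n) <->
  exists a b, [/\ a <= b, b <= n & v = window u a b].
Proof.
split=> [/infixP[s [t E]]|[a [b [ab bn ->]]]]; last first.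
  apply/infixP; exists (window u 0 a), (window u b n).
  by rewrite -window_cat ?ab// -window_cat//; lia.
have sz : n = size s + (size v + size t).
  by have := congr1 size E; rewrite size_window !size_cat subn0.
exists (size s), (size s + size v); split; [lia|lia|].
move: E; rewrite (@window_cat _ _ 0 (size s) n); last lia.
rewrite (@window_cat _ _ (size s) (size s + size v) n); last lia.
move/eqP; rewrite eqseq_cat; last by rewrite size_window subn0.
case/andP=> _; rewrite eqseq_cat; last by rewrite size_window addKn.
by case/andP=> /eqP-> _.
Qed.

(** [Theta] reverses the order of the three pieces cut at [a] and [b]; lengths match them with the
    pieces cut at the mirrored positions. *)
Lemma palindrome_mirror (A : finType) (Theta : seq A -> seq A) (u : nat -> A) s e a b :
  antimorphism Theta -> involutive Theta -> palindrome Theta (window u s e) ->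
  s <= a -> a <= b -> b <= e ->
  Theta (window u a b) = window u (s + e - b) (s + e - a).
Proof.
move=> Tanti Tinv /eqP pal sa ab be.
have Tsz := size_involutive_antimorphism Tanti Tinv.
move: pal; rewrite {1}(@window_cat _ _ s a e) ?(@window_cat _ _ a b e); try lia.
rewrite (@window_cat _ _ s (s + e - b) e); last lia.
rewrite (@window_cat _ _ (s + e - b) (s + e - a) e); last lia.
rewrite !Tanti -catA => /eqP.
rewrite eqseq_cat; last by rewrite Tsz !size_window; lia.
case/andP=> _; rewrite eqseq_cat; last by rewrite Tsz !size_window; lia.
by case/andP=> /eqP.
Qed.

(** * Longest palindromic suffixes *)

Lemma ex_palindromic_suffix (A : finType) (Theta : seq A -> seq A) (u : nat -> A) n :
  antimorphism Theta -> involutive Theta ->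
  exists s, palindrome Theta (window u s n).
Proof.
move=> Tanti Tinv; exists n; apply/eqP.
have -> : window u n n = [::] by apply: size0nil; rewrite size_window subnn.
by apply: size0nil; rewrite (size_involutive_antimorphism Tanti Tinv).
Qed.

(* [sigma n] is the starting position of the longest palindromic suffix of the
   prefix of length [n]. *)
Definition lps_start (A : finType) (Theta : seq A -> seq A) (u : nat -> A)
    (sigma : nat -> nat) : Prop :=
  forall n, [/\ sigma n <= n, palindrome Theta (window u (sigma n) n) &
    forall s, palindrome Theta (window u s n) -> sigma n <= s].

Lemma ex_lps_start (A : finType) (Theta : seq A -> seq A) (u : nat -> A) :
  antimorphism Theta -> involutive Theta -> exists sigma, lps_start Theta u sigma.
Proof.
move=> Tanti Tinv.
exists (fun n => ex_minn (ex_palindromic_suffix u n Tanti Tinv)) => n.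
case: ex_minnP => s ps min; split=> //.
(* A start beyond [n] gives the same empty window as the start [n]. *)
have [//|ns] := orP (leq_total s n); apply: min; move: ps; rewrite /palindrome.
have w0 m k : k <= m -> window u m k = [::].
  by move=> km; apply: size0nil; rewrite size_window; lia.
by rewrite !w0.
Qed.

(** Stripping both end letters of a palindromic suffix leaves a palindromic suffix of the previous
    prefix. *)
Lemma lps_start_step (A : finType) (Theta : seq A -> seq A) (u : nat -> A) sigma n :
  antimorphism Theta -> involutive Theta -> lps_start Theta u sigma ->
  sigma n <= (sigma n.+1).+1.
Proof.
move=> Tanti Tinv lps; have [sn _ smin] := lps n; have [s1 p1 _] := lps n.+1.
have [le|] := leqP (sigma n.+1).+1 n; last lia.
apply: smin; apply/eqP; rewrite (palindrome_mirror Tanti Tinv p1); try lia.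
by congr window; lia.
Qed.

(** * Counting palindromes *)

(** A shorter palindromic suffix is mirrored to a prefix of the longest one, so it occurred
    before. *)
Lemma Pal_window_step (A : finType) (Theta : seq A -> seq A) (u : nat -> A) sigma n :
  antimorphism Theta -> involutive Theta -> lps_start Theta u sigma ->
  {subset Pal Theta (window u 0 n.+1) <=
    window u (sigma n.+1) n.+1 :: Pal Theta (window u 0 n)}.
Proof.
move=> Tanti Tinv lps v; have [s1 p1 smin] := lps n.+1.
rewrite inE !mem_filter !mem_factors => /andP[pv /infix_window[a [b [ab bn E]]]].
rewrite pv; apply/orP.
have [bn'|nb] := leqP b n; first by right; apply/infix_window; exists a, b.
have {nb bn} bE : b = n.+1 by lia.
subst b; move: pv; rewrite E => pv; have := smin _ pv.
rewrite leq_eqVlt => /orP[/eqP->|sa]; [by left|right].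
apply/infix_window; exists (sigma n.+1), (sigma n.+1 + n.+1 - a); split; [lia|lia|].
move/eqP: pv => pv; rewrite -{1}pv (palindrome_mirror Tanti Tinv p1)//; last lia.
by congr window; lia.
Qed.

Definition lps_unioccurrent (A : finType) (u : nat -> A) (sigma : nat -> nat) n : Prop :=
  forall i, i < sigma n -> window u i (i + (n - sigma n)) <> window u (sigma n) n.

Lemma size_Pal_step (A : finType) (Theta : seq A -> seq A) (u : nat -> A) sigma n :
  antimorphism Theta -> involutive Theta -> lps_start Theta u sigma ->
  size (Pal Theta (window u 0 n.+1)) <= (size (Pal Theta (window u 0 n))).+1 /\
  (~ lps_unioccurrent u sigma n.+1 ->
   size (Pal Theta (window u 0 n.+1)) <= size (Pal Theta (window u 0 n))).
Proof.
move=> Tanti Tinv lps.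
have uP m : uniq (Pal Theta (window u 0 m)) by rewrite filter_uniq// undup_uniq.
have sub := Pal_window_step (n := n) Tanti Tinv lps.
split; first exact: uniq_leq_size sub.
move=> /existsNP[i /not_implyP[is_ /contrapT E]].
apply: uniq_leq_size => // v /sub; rewrite inE => /orP[/eqP->|//].
have [s1 p1 _] := lps n.+1.
rewrite mem_filter mem_factors p1 -E; apply/infix_window.
by exists i, (i + (n.+1 - sigma n.+1)); split=> //; lia.
Qed.

Lemma bounded_nondecreasing_nat_stationary (f : nat -> nat) C :
  (forall n, f n <= f n.+1) -> (forall n, f n <= C) ->
  exists N, forall n, N <= n -> f n.+1 = f n.
Proof.
move=> mono bnd.
have mono' : {homo f : m n / m <= n} by apply: homo_leq => //; apply: leq_trans.
have exf : exists m, `[<exists n, f n = m>] by exists (f 0); apply/asboolP; exists 0.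
have exb m : `[<exists n, f n = m>] -> m <= C by move=> /asboolP[n <-].
case: (ex_maxnP exf exb) => m /asboolP[N <-] max; exists N => n Nn.
have le k : f k <= f N by apply: max; apply/asboolP; exists k.
have := mono' _ _ Nn; have := le n; have := le n.+1; have := mono n; lia.
Qed.

(** A repeated lps adds a letter but no palindrome. As [gamma] is bounded, so is length minus number
    of palindromes, and this happens finitely often. *)
Lemma finite_defect_unioccurrent (A : finType) (Theta : seq A -> seq A) (u : nat -> A) sigma :
  antimorphism Theta -> involutive Theta -> lps_start Theta u sigma ->
  finite_defect Theta u ->
  exists N, forall n, N <= n -> lps_unioccurrent u sigma n.
Proof.
move=> Tanti Tinv lps [D [ubD _]].
pose pal n := size (Pal Theta (window u 0 n)).
have palS n : pal n.+1 <= (pal n).+1 by have [] := size_Pal_step n Tanti Tinv lps.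
have pal_le n : pal n <= pal 0 + n by elim: n => [|n]; [lia|have := palS n; lia].
have bnd n : n.+1 <= `|D|%N + #|{set A}| + pal n.
  have := ubD _ (window_language u 0 n); rewrite /defect size_window subn0.
  have : gamma Theta (window u 0 n) <= #|{set A}| by apply: max_card.
  rewrite -/(pal n); lia.
(* Adding [pal 0] keeps the truncated subtraction exact, by [pal_le]. *)
have [||N HN] := @bounded_nondecreasing_nat_stationary
  (fun n => pal 0 + n - pal n) (pal 0 + (`|D|%N + #|{set A}|)).
- by move=> n; have := palS n; lia.
- by move=> n; have := bnd n; lia.
exists N.+1 => -[//|n] Nn; apply: contrapT => nu.
have [_ /(_ nu)] := size_Pal_step n Tanti Tinv lps.
have := HN n Nn; have := pal_le n; have := pal_le n.+1; rewrite -/(pal n) -/(pal n.+1).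
lia.
Qed.

(* Unioccurrent suffixes of distinct prefixes are distinct words, and there are
   finitely many words of bounded length. *)
Lemma lps_length_unbounded (A : finType) (u : nat -> A) sigma N M :
  (forall n, sigma n <= n) ->
  (forall n, N <= n -> lps_unioccurrent u sigma n) ->
  exists J, forall n, J <= n -> M <= n - sigma n.
Proof.
move=> sle uni.
have last_occ (w : {bseq M of A}) :
    exists J, forall n, J <= n -> N <= n -> window u (sigma n) n <> w :> seq A.
  have [[j [Nj E]]|no] := pselect (exists j, N <= j /\ window u (sigma j) j = w).
    exists j.+1 => n jn Nn E'.
    have sz : j - sigma j = n - sigma n by rewrite -!(size_window u) E E'.
    apply: (uni n Nn (sigma j)); first by have := sle j; have := sle n; lia.
    by rewrite E' -sz subnKC.
  by exists 0 => n _ Nn E; apply: no; exists n.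
have [J HJ] := choice last_occ.
exists (maxn N (\max_w J w)) => n; rewrite geq_max => /andP[Nn Jn].
rewrite leqNgt; apply/negP => lt.
have szw : size (window u (sigma n) n) <= M by rewrite size_window ltnW.
apply: (HJ (Bseq szw) n) => //; apply: leq_trans Jn; exact: leq_bigmax.
Qed.

(** * Periods and overlaps *)

Lemma window_eqP (A : finType) (u : nat -> A) a b n :
  (forall x, x < n -> u (a + x) = u (b + x)) <->
  window u a (a + n) = window u b (b + n).
Proof.
split=> [E|E x xn].
  apply: (@eq_from_nth _ (u 0)); first by rewrite !size_window !addKn.
  by move=> i; rewrite size_window addKn => ?; rewrite !nth_window ?addKn// E.
have := congr1 (fun s => nth (u 0) s x) E.
by rewrite !nth_window ?addKn.
Qed.

(** Period [e] on length [2 * e + 1] gives a square followed by its own first letter. *)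
Lemma overlapping_of_period (A : finType) (u : nat -> A) a e :
  0 < e -> window u a (a + e.+1) = window u (a + e) (a + e + e.+1) ->
  overlapping_factors u (window u a (a + e + e.+1)).
Proof.
move=> e0 /window_eqP E; exists (window u a (a + e)), (window u a (a + 1)).
split; last exact: window_language.
- rewrite (@window_cat _ _ a (a + e) (a + e + e.+1)); last lia.
  rewrite (@window_cat _ _ (a + e) (a + e + e) (a + e + e.+1)); last lia.
  congr (_ ++ (_ ++ _)).
    by apply/esym/window_eqP => x xe; apply: E; lia.
  rewrite -[e.+1]addn1 addnA; apply/esym/window_eqP => -[|//] _; rewrite addn0.
  by have := E 0 isT; have := E e (ltnSn e); rewrite !addn0 => <- <-.
- by rewrite -size_eq0 size_window addKn.
- by apply/prefixP; exists (window u (a + 1) (a + e)); rewrite -window_cat//; lia.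
Qed.

(* Two occurrences at distance [d] give the period [d]; the multiple [m * d] of
   that period is chosen so that [2 m d] exceeds half the length [n + d - 1]. *)
Lemma finite_overlapping_factors_disjoint (A : finType) (u : nat -> A) :
  finite_set (overlapping_factors u) ->
  exists K, forall a b n, K <= n -> a < b -> b < a + n ->
    window u a (a + n) <> window u b (b + n).
Proof.
move=> /finite_seqP[s Es].
pose K := \max_(x <- s) size x.
have HK x : overlapping_factors u x -> size x <= K.
  by rewrite Es /= => xs; apply: leq_bigmax_seq.
(* Half of [n + d - 1] then exceeds [K], and so does the overlap built below. *)
exists (2 * K + 2) => a b n Kn ab ban /window_eqP E.
set d := b - a.
have Ed x : x < n -> u (a + x) = u (a + d + x).
  by move=> xn; rewrite E// /d subnKC// ltnW.
have Em m x : x + m * d < n + d -> u (a + x) = u (a + m * d + x).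
  elim: m => [|m IHm] lt; first by rewrite mul0n addn0.
  rewrite IHm; last by rewrite mulSn in lt; lia.
  rewrite -addnA Ed; first by congr u; rewrite mulSn; lia.
  by rewrite mulSn in lt; lia.
have d0 : 0 < d by rewrite subn_gt0.
pose m := (n + d).-1 %/ (2 * d).
have le : m * (2 * d) <= (n + d).-1 by apply: leq_divM.
have lt : (n + d).-1 < m.+1 * (2 * d) by rewrite ltn_ceil// muln_gt0.
have m0 : 0 < m by rewrite divn_gt0 ?muln_gt0//; lia.
have md : d <= m * d by rewrite leq_pmull.
have := HK _ (@overlapping_of_period _ u a (m * d) _ _).
rewrite size_window; move: le lt; rewrite mulnCA mulSn mulnCA => le lt.
suff : (0 < m * d) /\
    window u a (a + (m * d).+1) = window u (a + m * d) (a + m * d + (m * d).+1).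
  by move=> [p1 p2] /(_ p1 p2); lia.
split; first lia.
by apply/window_eqP => x xe; apply: Em; lia.
Qed.

(** * Starting positions after a break *)

(* Otherwise the mirror image of [window u (sigma k) k] in the palindrome
   [window u (sigma j) j] starts with the longest palindromic suffix of the
   prefix of length [k.+1] stripped of its end letters, so it overlaps
   [window u (sigma k) k]. *)
Lemma lps_start_after_jump (A : finType) (Theta : seq A -> seq A) (u : nat -> A) sigma K k j :
  antimorphism Theta -> involutive Theta -> lps_start Theta u sigma ->
  (forall a b n, K <= n -> a < b -> b < a + n ->
    window u a (a + n) <> window u b (b + n)) ->
  K <= k - sigma k -> 2 < k.+1 - sigma k.+1 ->
  sigma k <= sigma k.+1 -> k < j -> sigma k.+1 + k.+1 = sigma j + j ->
  sigma k < sigma j.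
Proof.
move=> Tanti Tinv lps disj Kk L3 jump kj center.
rewrite ltnNge; apply/negP => sj.
have [sk /eqP pk _] := lps k; have [_ pj _] := lps j.
have := palindrome_mirror Tanti Tinv pj sj sk (ltnW kj); rewrite pk.
have -> : sigma j + j - k = (sigma k.+1).+1 by lia.
have -> : sigma j + j - sigma k = (sigma k.+1).+1 + (k - sigma k) by lia.
rewrite -{2}(subnKC sk); apply: disj => //; lia.
Qed.

(** Induction over the breaks, the [k] with [sigma k <= sigma k.+1]: each one starts after the
    previous one by [lps_start_after_jump], whose two length conditions are covered by [K + 3]. *)
Lemma lps_start_after_break (A : finType) (Theta : seq A -> seq A) (u : nat -> A) sigma K J j i :
  antimorphism Theta -> involutive Theta -> lps_start Theta u sigma ->
  (forall a b n, K <= n -> a < b -> b < a + n ->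
    window u a (a + n) <> window u b (b + n)) ->
  (forall n, J <= n -> K + 3 <= n - sigma n) ->
  J <= j -> sigma j <= sigma j.+1 -> j < i -> sigma j < sigma i.
Proof.
move=> Tanti Tinv lps disj long Jj brk ji.
have jump k n : j <= k -> sigma k <= sigma k.+1 -> k < n ->
    sigma k.+1 + k.+1 = sigma n + n -> sigma k < sigma n.
  move=> jk; apply: (lps_start_after_jump Tanti Tinv lps disj).
    by have := long k; lia.
  by have := long k.+1; lia.
(* [k] is the last break before [i]; from [k.+1] to [i] each step extends the palindrome on both
   sides, so its centre stays fixed. *)
have [k [jk ki brk_k center jk_start]] : exists k, [/\ j <= k, k < i,
    sigma k <= sigma k.+1, sigma k.+1 + k.+1 = sigma i + i & sigma j <= sigma k].
  elim: i ji => // i IHi; rewrite ltnS leq_eqVlt => /orP[/eqP<-|ji].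
    by exists j; split.
  have [k [jk ki bk ck jks]] := IHi ji.
  have [bi|gi] := leqP (sigma i) (sigma i.+1).
    exists i; split=> //; first exact: ltnW.
    by apply: leq_trans jks _; apply: ltnW; apply: jump bk _ _.
  exists k; split=> //; first lia.
  have := lps_start_step i Tanti Tinv lps; lia.
by apply: leq_ltn_trans jk_start _; apply: jump.
Qed.

(** Otherwise [sigma] would decrease strictly forever. *)
Lemma ex_break (sigma : nat -> nat) J : exists j, J <= j /\ sigma j <= sigma j.+1.
Proof.
apply: contrapT => no.
have dec n : J <= n -> sigma n.+1 < sigma n.
  by move=> Jn; rewrite ltnNge; apply/negP => ?; apply: no; exists n.
have le n : sigma (J + n) + n <= sigma J.
  elim: n => [|n IHn]; first by rewrite !addn0.
  by rewrite !addnS; have := dec (J + n) (leq_addr n J); lia.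
have := le (sigma J).+1; lia.
Qed.

Theorem theorem2 (A : finType) (Theta : seq A -> seq A) (u : nat -> A)
  (Theta_anti : antimorphism Theta) (Theta_inv : involutive Theta)
  (u_rec : recurrent u) (u_def : finite_defect Theta u) :
  infinite_set (overlapping_factors u).
Proof.
move=> /finite_overlapping_factors_disjoint[K disj].
have [sigma lps] := ex_lps_start u Theta_anti Theta_inv.
have sle n : sigma n <= n by have [] := lps n.
have [N uni] := finite_defect_unioccurrent Theta_anti Theta_inv lps u_def.
have [J long] := lps_length_unbounded (K + 3) sle uni.
have [j [/[!geq_max]/andP[Jj Nj] brk]] := ex_break sigma (maxn J N).
have after := lps_start_after_break Theta_anti Theta_inv lps disj long Jj brk.
pose n := j - sigma j.
pose later i := (sigma j < i) && (window u i (i + n) == window u (sigma j) j).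
(* One of two distinct occurrences is not at [sigma j], and unioccurrence at [j] forbids it to be
   earlier. *)
have exl : exists i, later i.
  have occ i : occurs_at u (window u (sigma j) j) i ->
      i <> sigma j -> later i.
    rewrite /occurs_at size_window -/n => E ij.
    have Ei : window u i (i + n) = window u (sigma j) j.
      by rewrite E /window /index_iota addKn.
    rewrite /later Ei eqxx andbT ltn_neqAle eq_sym; apply/andP; split; first exact/eqP.
    by rewrite leqNgt; apply/negP => lt; apply: (uni j Nj i lt).
  have [a [b [/eqP ab oa ob]]] := u_rec _ (window_language u (sigma j) j).
  have [E|ne] := eqVneq a (sigma j); last by exists a; apply: occ => //; apply/eqP.
  by exists b; apply: occ => // E'; apply: ab; rewrite E E'.
(* The next occurrence [i] of the palindrome [q = window u (sigma j) j] ends a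
   longest palindromic suffix that, being unioccurrent, is longer than [q]; as
   it starts with [q], it reaches back to [sigma j]. *)
case: (ex_minnP exl) => i /andP[ji /eqP Ei] imin.
have jn : j = sigma j + n by rewrite subnKC.
have Nin : N <= i + n by lia.
have [_ /eqP pq _] := lps j.
have [_ pin min_in] := lps (i + n).
have le_i : sigma (i + n) <= i by apply: min_in; rewrite Ei; apply/eqP.
have lt_in : sigma j < sigma (i + n) by apply: after; lia.
have [si|ne] := eqVneq (sigma (i + n)) i.
  apply: (uni (i + n) Nin (sigma j)) => //.
  by rewrite si addKn -jn Ei.
have := palindrome_mirror Theta_anti Theta_inv pin le_i (leq_addr n i) (leqnn _).
rewrite Ei pq addnK => E.
have : later (sigma (i + n)).
  rewrite /later lt_in E; apply/eqP; congr window; lia.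
by move=> /imin; lia.
Qed.
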